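(* Let $(M_1\times_f M_2,F)$ be a flat twisted product Finsler manifold and suppose $(M_2,F_2)$ is Riemannian. If $f$ is a function on $M_1$ only, then $(M_2,F_2)$ is a space of positive constant curvature $\|\mathrm{grad} f\|^2$.
   Context: Let $(M_1,F_1)$, $(M_2,F_2)$ be Finsler manifolds (metrics smooth on the slit tangent bundle, positively 1-homogeneous on fibres, with positive definite fundamental tensor) and $f:M_1\times M_2\to\mathbb{R}^+$ smooth. The twisted product $M_1\times_f M_2$ is $M=M_1\times M_2$ with $F=\sqrt{F_1^2(x,y)+f^2(x,u)F_2^2(u,v)}$, considered where $y\ne0$, $v\ne 0$. Local coordinates are $\mathbf{x}^a=(x^i,u^\alpha)$ with fibre coordinates $\mathbf{y}^a=(y^i,v^\alpha)$; $g_{ij}=\frac12\frac{\partial^2F_1^2}{\partial y^i\partial y^j}$, $g_{\alpha\beta}=\frac12\frac{\partial^2F_2^2}{\partial v^\alpha\partial v^\beta}$. Put $\mathbf g_{ab}=\frac12\frac{\partial^2F^2}{\partial\mathbf y^a\partial\mathbf y^b}$, $\mathbf G^a=\frac14\mathbf g^{ab}\big(\frac{\partial^2F^2}{\partial\mathbf y^b\partial\mathbf x^c}\mathbf y^c-\frac{\partial F^2}{\partial\mathbf x^b}\big)$, $\mathbf G^a_b=\frac{\partial\mathbf G^a}{\partial\mathbf y^b}$, $\frac{\delta^t}{\delta^t\mathbf x^a}=\frac{\partial}{\partial\mathbf x^a}-\mathbf G^b_a\frac{\partial}{\partial\mathbf y^b}$, and $$\mathbf F^c_{ab}=\tfrac12\mathbf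 g^{ce}\Big(\frac{\delta^t\mathbf g_{ea}}{\delta^t\mathbf x^b}+\frac{\delta^t\mathbf g_{eb}}{\delta^t\mathbf x^a}-\frac{\delta^t\mathbf g_{ab}}{\delta^t\mathbf x^e}\Big),\qquad \mathbf R^{\ a}_{b\ cd}=\frac{\delta^t\mathbf F^a_{bc}}{\delta^t\mathbf x^d}-\frac{\delta^t\mathbf F^a_{bd}}{\delta^t\mathbf x^c}+\mathbf F^a_{de}\mathbf F^e_{bc}-\mathbf F^a_{ce}\mathbf F^e_{bd}.$$ $(M_1\times_fM_2,F)$ is flat if $\mathbf R^{\ a}_{b\ cd}=0$. ''$f$ is a function on $M_1$ only'' means $\partial f/\partial u^\alpha=0$. With $f_i=\partial f/\partial x^i$, $\|\mathrm{grad} f\|^2=g^{ij}f_if_j$. A Riemannian manifold is a space of constant curvature $K$ if all its sectional curvatures equal the constant $K$.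
   Formalization: Manifolds are taken connected; positivity of ‖grad f‖² is asserted only at points where df ≠ 0 (for constant f the curvature is 0), and that ‖grad f‖² is a single constant is asserted only for dim M_2 ≥ 2 (for dim M_2 = 1 there are no sectional curvatures and it can fail). *)

(* Defs.v *)
From HB Require Import structures.
From mathcomp Require Import all_boot all_order all_algebra.
From mathcomp Require Import all_classical all_reals all_analysis.

Set Implicit Arguments.
Unset Strict Implicit.
Unset Printing Implicit Defensive.

Import Order.TTheory GRing.Theory Num.Theory.
Import numFieldNormedType.Exports.

Local Open Scope classical_set_scope.
Local Open Scope ring_scope.

Section Calculus.
Context {R : realType} {n : nat}.

Definition partial (k : 'I_n) (f : 'rV[R]_n -> R) (x : 'rV[R]_n) : R :=
  'D_(delta_mx 0 k) f x.

Definition iter_partial (s : seq 'I_n) (f : 'rV[R]_n -> R) : 'rV[R]_n -> R :=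
  foldr partial f s.

(* For U open, this is C^oo on U: every iterated partial derivative exists and is
   continuous at every point of U. *)
Definition smooth_on (U : set 'rV[R]_n) (f : 'rV[R]_n -> R) : Prop :=
  forall (s : seq 'I_n) (x : 'rV[R]_n), U x ->
    {for x, continuous (iter_partial s f)} /\
    (forall k, derivable (iter_partial s f) x (delta_mx 0 k)).

End Calculus.

(* Connected, Hausdorff, second countable smooth n-manifold, given by an atlas
   of charts indexed by [chart]; [coord i] is the homeomorphism from the open
   set [dom i] onto its open image and [param i] is its inverse (both total,
   with irrelevant values elsewhere). *)
Record smooth_manifold (R : realType) (n : nat) := SmoothManifold {
  carrier :> topologicalType ;
  chart : Type ;
  dom : chart -> set carrier ;
  coord : chart -> carrier -> 'rV[R]_n ;
  param : chart -> 'rV[R]_n -> carrier ;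
  manifold_nonempty : [set: carrier] !=set0 ;
  manifold_connected : connected [set: carrier] ;
  manifold_hausdorff : hausdorff_space carrier ;
  manifold_second_countable : @second_countable carrier ;
  dom_open : forall i, open (dom i) ;
  dom_cover : forall p, exists i, dom i p ;
  coordK : forall i p, dom i p -> param i (coord i p) = p ;
  coord_image_open : forall i, open (coord i @` dom i) ;
  coord_continuous : forall i p, dom i p -> {for p, continuous (coord i)} ;
  param_continuous : forall i x, (coord i @` dom i) x ->
    {for x, continuous (param i)} ;
  transition_smooth : forall i j (k : 'I_n),
    smooth_on [set x | (coord i @` dom i) x /\ dom j (param i x)]
              (fun x => coord j (param i x) 0 k)
}.

Arguments chart {R n}.
Arguments dom {R n} _ _ _.
Arguments coord {R n} _ _ _.
Arguments param {R n} _ _ _.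

Section Manifold.
Context {R : realType} {n : nat} (M : smooth_manifold R n).

Definition chart_image (i : chart M) : set 'rV[R]_n := coord M i @` dom M i.

Definition overlap (i j : chart M) : set 'rV[R]_n :=
  [set x | chart_image i x /\ dom M j (param M i x)].

Definition transition (i j : chart M) (x : 'rV[R]_n) : 'rV[R]_n :=
  coord M j (param M i x).

End Manifold.

(* Tensor calculus of a Finsler function L(x, y) in one coordinate system, with
   base coordinates x and fibre coordinates y. *)
Section LocalFinsler.
Context {R : realType} {n : nat}.
Implicit Types (L phi : 'rV[R]_n -> 'rV[R]_n -> R) (x y : 'rV[R]_n).

Definition dbase (a : 'I_n) phi x y : R := partial a (fun x' => phi x' y) x.

Definition dfibre (a : 'I_n) phi x y : R := partial a (phi x) y.

Definition energy L x y : R := L x y ^+ 2.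

Definition fundamental_tensor L x y : 'M[R]_n :=
  \matrix_(a, b) (2^-1 * dfibre a (dfibre b (energy L)) x y).

Definition inverse_tensor L x y : 'M[R]_n := invmx (fundamental_tensor L x y).

Definition spray L (a : 'I_n) x y : R :=
  4^-1 * \sum_b inverse_tensor L x y a b *
    (\sum_c dfibre b (dbase c (energy L)) x y * y 0 c
     - dbase b (energy L) x y).

(* [nonlinear_connection L a b] is G^a_b = dG^a / dy^b *)
Definition nonlinear_connection L (a b : 'I_n) x y : R :=
  dfibre b (spray L a) x y.

Definition delta L (a : 'I_n) phi x y : R :=
  dbase a phi x y - \sum_b nonlinear_connection L b a x y * dfibre b phi x y.

(* [hconnection L c a b] is F^c_{ab} *)
Definition hconnection L (c a b : 'I_n) x y : R :=
  2^-1 * \sum_e inverse_tensor L x y c e *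
    (delta L b (fun x' y' => fundamental_tensor L x' y' e a) x y
     + delta L a (fun x' y' => fundamental_tensor L x' y' e b) x y
     - delta L e (fun x' y' => fundamental_tensor L x' y' a b) x y).

(* [hhcurvature L b a c d] is R_b^a_{cd} *)
Definition hhcurvature L (b a c d : 'I_n) x y : R :=
  delta L d (hconnection L a b c) x y - delta L c (hconnection L a b d) x y
  + \sum_e hconnection L a d e x y * hconnection L e b c x y
  - \sum_e hconnection L a c e x y * hconnection L e b d x y.

End LocalFinsler.

(* A Finsler metric is given by its expressions F i (x, y) in the charts: y
   collects the components of a tangent vector in the coordinate frame of the
   chart i, and the expressions in two charts agree on their overlap. *)
Record finsler_metric (R : realType) (n : nat) (M : smooth_manifold R n) :=
  FinslerMetric {
  finsler_expr :> chart M -> 'rV[R]_n -> 'rV[R]_n -> R ;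
  finsler_ge0 : forall i x y, chart_image i x -> 0 <= finsler_expr i x y ;
  finsler_transition : forall i j x y, overlap i j x ->
    finsler_expr j (transition i j x) ('D_y (transition i j) x)
    = finsler_expr i x y ;
  finsler_smooth : forall i,
    smooth_on [set z : 'rV[R]_(n + n) |
                chart_image i (lsubmx z) /\ rsubmx z != 0]
              (fun z => finsler_expr i (lsubmx z) (rsubmx z)) ;
  finsler_homogeneous : forall i x y (t : R), chart_image i x -> 0 < t ->
    finsler_expr i x (t *: y) = t * finsler_expr i x y ;
  finsler_posdef : forall i x y (w : 'rV[R]_n),
    chart_image i x -> y != 0 -> w != 0 ->
    0 < (w *m fundamental_tensor (finsler_expr i) x y *m w^T) 0 0
}.

Section LocalRiemann.
Context {R : realType} {n : nat}.
Implicit Types (h : 'rV[R]_n -> 'M[R]_n) (x X Y Z : 'rV[R]_n).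

(* [christoffel h c a b] is Gamma^c_{ab} *)
Definition christoffel h (c a b : 'I_n) x : R :=
  2^-1 * \sum_e invmx (h x) c e *
    (partial a (fun x' => h x' e b) x + partial b (fun x' => h x' e a) x
     - partial e (fun x' => h x' a b) x).

(* R(d_c, d_d) d_b = \sum_a riemann h a b c d d_a *)
Definition riemann h (a b c d : 'I_n) x : R :=
  partial c (christoffel h a d b) x - partial d (christoffel h a c b) x
  + \sum_e christoffel h a c e x * christoffel h e d b x
  - \sum_e christoffel h a d e x * christoffel h e c b x.

Definition metric_pairing h x X Y : R := (X *m h x *m Y^T) 0 0.

Definition riemann_op h x X Y Z : 'rV[R]_n :=
  \row_a \sum_b \sum_c \sum_d riemann h a b c d x * X 0 c * Y 0 d * Z 0 b.

Definition sectional_curvature h x X Y : R :=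
  metric_pairing h x (riemann_op h x X Y Y) X /
  (metric_pairing h x X X * metric_pairing h x Y Y
   - metric_pairing h x X Y ^+ 2).

End LocalRiemann.

Section Riemannian.
Context {R : realType} {n : nat} {M : smooth_manifold R n}.

(* F is Riemannian, and h is its metric tensor in the charts *)
Definition is_riemannian (F : finsler_metric M)
    (h : chart M -> 'rV[R]_n -> 'M[R]_n) : Prop :=
  forall i x, chart_image i x ->
    (h i x)^T = h i x /\
    (forall y, F i x y ^+ 2 = (y *m h i x *m y^T) 0 0).

Definition constant_curvature (h : chart M -> 'rV[R]_n -> 'M[R]_n) (K : R) :
    Prop :=
  forall i x (X Y : 'rV[R]_n), chart_image i x -> row_free (col_mx X Y) ->
    sectional_curvature (h i) x X Y = K.

End Riemannian.

Section TwistedProduct.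
Context {R : realType} {n1 n2 : nat}.
Context {M1 : smooth_manifold R n1} {M2 : smooth_manifold R n2}.
Variables (F1 : finsler_metric M1) (F2 : finsler_metric M2).
Variable f : M1 * M2 -> R.

Definition fun_expr (i : chart M1) (j : chart M2) (x : 'rV[R]_n1)
    (u : 'rV[R]_n2) : R :=
  f (param M1 i x, param M2 j u).

Definition smooth_on_product : Prop :=
  forall i j,
    smooth_on [set z : 'rV[R]_(n1 + n2) |
                chart_image i (lsubmx z) /\ chart_image j (rsubmx z)]
              (fun z => fun_expr i j (lsubmx z) (rsubmx z)).

Definition twisted_metric (i : chart M1) (j : chart M2)
    (x y : 'rV[R]_(n1 + n2)) : R :=
  Num.sqrt (F1 i (lsubmx x) (lsubmx y) ^+ 2
            + fun_expr i j (lsubmx x) (rsubmx x) ^+ 2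
              * F2 j (rsubmx x) (rsubmx y) ^+ 2).

Definition twisted_flat : Prop :=
  forall i j (x y : 'rV[R]_(n1 + n2)) (a b c d : 'I_(n1 + n2)),
    chart_image i (lsubmx x) -> chart_image j (rsubmx x) ->
    lsubmx y != 0 -> rsubmx y != 0 ->
    hhcurvature (twisted_metric i j) b a c d x y = 0.

Definition function_on_first_factor : Prop :=
  forall i j x u (k : 'I_n2), chart_image i x -> chart_image j u ->
    partial k (fun_expr i j x) u = 0.

Definition differential1 (i : chart M1) (j : chart M2) (x : 'rV[R]_n1)
    (u : 'rV[R]_n2) : 'rV[R]_n1 :=
  \row_k partial k (fun x' => fun_expr i j x' u) x.

Definition grad_norm2 (i : chart M1) (j : chart M2) (x y : 'rV[R]_n1)
    (u : 'rV[R]_n2) : R :=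
  \sum_k \sum_l inverse_tensor (F1 i) x y k l
    * differential1 i j x u 0 k * differential1 i j x u 0 l.

End TwistedProduct.

(* Main.v *)
(** Since f does not depend on the second factor, the twisted metric reads
    F^2 = F1^2(x, y) + f(x)^2 h_u(v, v) in product coordinates, and its
    fundamental tensor is the block matrix diag(g1(x, y), f(x)^2 h(u)).  The
    second block does not depend on the fibre coordinates, so its horizontal
    derivatives are plain partial derivatives and the spray drops out.  Hence,
    with a, b, c, d indices of the second factor and k, l indices of the first,
      F^a_bc = Gamma^a_bc,   F^a_bk = (f_k / f) delta^a_b,
      F^k_bc = - f h_bc g1^kl f_l,
    where Gamma are the Christoffel symbols of h, and therefore
      R_b^a_cd = |grad f|^2 (delta^a_c h_bd - delta^a_d h_bc) - Riem(h)^a_bcd.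
    Flatness makes h a metric of constant curvature |grad f|^2.  That this
    number is the same in every chart of the second factor rests on the
    connectedness of M2: a function whose partial derivatives vanish in all
    charts is constant. *)

From HB Require Import structures.
From mathcomp Require Import all_boot all_order all_algebra.
From mathcomp Require Import ring.
From mathcomp Require Import all_classical all_reals all_analysis.
Require Import Defs.

Set Implicit Arguments.
Unset Strict Implicit.
Unset Printing Implicit Defensive.

Import Order.TTheory GRing.Theory Num.Theory.
Import numFieldNormedType.Exports.

Local Open Scope classical_set_scope.
Local Open Scope ring_scope.

Section EqIncrement.
Context {R : numFieldType} {V1 V2 W : normedModType R}.
Variables (f : V1 -> W) (g : V2 -> W) (a v : V1) (b w : V2).
Hypothesis fg : forall t : R, f (t *: v + a) - f a = g (t *: w + b) - g b.

Let eq_difference_quotient :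
  (fun t : R => t^-1 *: ((f \o shift a) (t *: v) - f a)) =
  (fun t : R => t^-1 *: ((g \o shift b) (t *: w) - g b)).
Proof. by apply/funext => t; rewrite /= fg. Qed.

Lemma eq_increment_derive : 'D_v f a = 'D_w g b.
Proof. by rewrite /derive eq_difference_quotient. Qed.

Lemma eq_increment_derivable : derivable f a v <-> derivable g b w.
Proof. by rewrite /derivable eq_difference_quotient. Qed.

End EqIncrement.

Section DirectionalDerivative.
Context {R : realFieldType} {V : normedModType R}.
Implicit Types (a v : V) (g : V -> R).

Lemma near_line (U : set V) a v :
  nbhs a U -> \forall t \near (0 : R), U (t *: v + a).
Proof.
have : ((fun t : R => t *: v + a) @ (0 : R)) --> (0 : R) *: v + a.
  apply: cvgD; last exact: cvg_cst.
  by apply: cvgZr_tmp; exact: cvg_id.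
by rewrite scale0r add0r => /[apply].
Qed.

Lemma is_derive_line g a v (t dg : R) :
  is_derive (t *: v + a) v g dg ->
  is_derive t 1 (fun s : R => g (s *: v + a)) dg.
Proof.
move=> [gv <-]; pose line (s : R) := g (s *: v + a).
have increment (r : R) : line (r *: (1 : R) + t) - line t =
    g (r *: v + (t *: v + a)) - g (t *: v + a).
  by rewrite /line addrA -scalerDl /GRing.scale /= mulr1.
apply: DeriveDef; first exact/(eq_increment_derivable increment).
exact: eq_increment_derive increment.
Qed.

Lemma derive_line g a v : 'D_v g a = 'D_1 (fun t : R => g (t *: v + a)) 0.
Proof.
apply: eq_increment_derive => t.
by rewrite scale0r add0r addr0 /GRing.scale /= mulr1.
Qed.

Lemma derive_near_cst g a v :
  (\forall t \near (0 : R), g (t *: v + a) = g a) -> 'D_v g a = 0.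
Proof.
by rewrite derive_line => /near_eq_derive ->; exact: derive_cst.
Qed.

Lemma derive_horner g a v (p : {poly R}) :
  (forall t, g (t *: v + a) = p.[t]) -> 'D_v g a = p`_1.
Proof.
move=> /funext gp; rewrite derive_line gp.
rewrite (@derive_val _ _ _ _ _ _ _ (is_derive_poly p 0)).
by rewrite horner_coef0 coef_deriv mulr1n.
Qed.

End DirectionalDerivative.

Lemma is_derive_0_cst_itv {R : realType} (f : R -> R) (a b : R) :
  {in `[a, b], forall t, is_derive t (1 : R) f 0} ->
  {in `[a, b] &, forall s t, f s = f t}.
Proof.
move=> df s t sab tab; wlog st : s t sab tab / s <= t.
  by move=> fst; case: (leP s t) => [|/ltW] st; [|apply/esym]; exact: fst.
move: sab tab; rewrite !in_itv /= => /andP[le_as _] /andP[_ tb].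
have subitv r : r \in `[s, t] -> is_derive r (1 : R) f 0.
  rewrite in_itv /= => /andP[sr rt]; apply: df.
  by rewrite in_itv /= (le_trans le_as sr) (le_trans rt tb).
have [|_ _] := MVT_segment st (fun r rst => subitv r (subset_itv_oo_cc rst)).
  by apply: derivable_within_continuous => r /subitv[].
by rewrite mul0r => /eqP; rewrite subr_eq0 => /eqP.
Qed.

Lemma connected_locally_constant (T : topologicalType) (S : Type) (g : T -> S) :
  connected [set: T] -> (forall p, \forall q \near p, g q = g p) ->
  forall p q, g p = g q.
Proof.
move=> connT g_near p q.
have preimage_open (A : set S) : open (g @^-1` A).
  by rewrite openE => r Ar; apply: filterS (g_near r) => z /= ->.
suff /seteqP[_ /(_ p)] : g @^-1` [set g q] = [set: T] by exact.
apply: connT; first by exists q.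
- by exists (g @^-1` [set g q]); rewrite ?setTI.
- exists (g @^-1` [set g q]); last by rewrite setTI.
  by rewrite -openC preimage_setC.
Qed.

Section PartialDerivatives.
Context {R : realType} {n : nat}.
Implicit Types (g : 'rV[R]_n -> R) (U : set 'rV[R]_n) (x : 'rV[R]_n) (k : 'I_n).

Lemma eq_on_partial g1 g2 U x k : open U -> U x ->
  {in U, g1 =1 g2} -> partial k g1 x = partial k g2 x.
Proof.
move=> oU Ux g12; apply: near_eq_derive.
apply: filterS (open_nbhs_nbhs (conj oU Ux)) => z Uz.
by apply: g12; rewrite inE.
Qed.

Lemma partial_cst (c : R) x k : partial k (fun=> c) x = 0.
Proof. exact: derive_cst. Qed.

Lemma partial0_line g x k (s : R) :
  (forall t, `|t| <= `|s| -> is_derive (t *: 'e_k + x) 'e_k g 0) ->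
  g (s *: 'e_k + x) = g x.
Proof.
move=> dg; pose line (t : R) := g (t *: 'e_k + x).
have /is_derive_0_cst_itv line_cst :
    {in `[- `|s|, `|s|], forall t, is_derive t (1 : R) line 0}.
  by move=> t; rewrite in_itv /= -ler_norml => /dg/is_derive_line.
rewrite -/(line s) (line_cst s 0) ?in_itv /= -?ler_norml ?normr0 //.
by rewrite /line scale0r add0r.
Qed.

(* Two points of a sup-norm ball are joined inside it by axis-parallel
   segments. *)
Lemma partial0_locally_constant g U x : open U -> U x ->
  (forall z k, U z -> is_derive z 'e_k g 0) -> \forall z \near x, g z = g x.
Proof.
move=> oU Ux dg.
have /nbhs_ballP[e e0 eU] : nbhs x U by exact: open_nbhs_nbhs.
apply/nbhs_ballP; exists e => // z [_ xz].
have near_coord l : `|x 0 l - z 0 l| < e by exact: xz.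
pose corner m : 'rV[R]_n := \row_l if (l < m)%N then z 0 l else x 0 l.
have corner0 : corner 0%N = x by apply/rowP => l; rewrite mxE.
have cornern : corner n = z by apply/rowP => l; rewrite mxE ltn_ord.
suff g_corner m : (m <= n)%N -> g (corner m) = g x by rewrite -cornern g_corner.
elim: m => [|m IHm] mn; first by rewrite corner0.
rewrite -IHm ?(ltnW mn) //; pose k := Ordinal mn.
have -> : corner m.+1 = (z 0 k - x 0 k) *: 'e_k + corner m.
  apply/rowP => l; rewrite !mxE eqxx /= ltnS leq_eqVlt.
  have [->|] := eqVneq l k; first by rewrite /= eqxx ltnn mulr1 subrK.
  by rewrite -val_eqE /= => /negbTE ->; rewrite mulr0 add0r.
apply: partial0_line => t t_le; apply: dg; apply: eU; split => // i l.
rewrite (ord1 i) !mxE eqxx /= /ball /=; have [->|_] := eqVneq l k.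
  rewrite ltnn mulr1 opprD addrCA subrr addr0 normrN.
  by apply: le_lt_trans t_le _; rewrite distrC.
by rewrite mulr0 add0r; case: ifP => _; rewrite ?subrr ?normr0 ?near_coord.
Qed.

End PartialDerivatives.

Section BlockCoordinates.
Context {R : realType} {n1 n2 : nat} (g : 'rV[R]_(n1 + n2) -> R).
Implicit Types (x : 'rV[R]_n1) (u : 'rV[R]_n2).

Let increment_lshift x u k (t : R) :
  g (t *: 'e_(lshift n2 k) + row_mx x u) - g (row_mx x u) =
  g (row_mx (t *: 'e_k + x) u) - g (row_mx x u).
Proof.
by rewrite delta_mx_lshift scale_row_mx add_row_mx scaler0 add0r.
Qed.

Let increment_rshift x u k (t : R) :
  g (t *: 'e_(rshift n1 k) + row_mx x u) - g (row_mx x u) =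
  g (row_mx x (t *: 'e_k + u)) - g (row_mx x u).
Proof.
by rewrite delta_mx_rshift scale_row_mx add_row_mx scaler0 add0r.
Qed.

Lemma partial_lshift x u k :
  partial (lshift n2 k) g (row_mx x u) =
  partial k (fun x' => g (row_mx x' u)) x.
Proof. exact: eq_increment_derive (increment_lshift x u k). Qed.

Lemma partial_rshift x u k :
  partial (rshift n1 k) g (row_mx x u) =
  partial k (fun u' => g (row_mx x u')) u.
Proof. exact: eq_increment_derive (increment_rshift x u k). Qed.

Lemma derivable_lshift x u k :
  derivable g (row_mx x u) 'e_(lshift n2 k) <->
  derivable (fun x' => g (row_mx x' u)) x 'e_k.
Proof. exact: eq_increment_derivable (increment_lshift x u k). Qed.

Lemma derivable_rshift x u k :
  derivable g (row_mx x u) 'e_(rshift n1 k) <->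
  derivable (fun u' => g (row_mx x u')) u 'e_k.
Proof. exact: eq_increment_derivable (increment_rshift x u k). Qed.

End BlockCoordinates.

Section SmoothSlices.
Context {R : realType} {n1 n2 : nat} (g : 'rV[R]_n1 -> 'rV[R]_n2 -> R).
Variable U : set 'rV[R]_(n1 + n2).
Hypothesis g_smooth : smooth_on U (fun z => g (lsubmx z) (rsubmx z)).
Implicit Types (x : 'rV[R]_n1) (u : 'rV[R]_n2).

Lemma smooth_on_derivablel x u k :
  U (row_mx x u) -> derivable (fun x' => g x' u) x 'e_k.
Proof.
move=> /(@g_smooth [::])[_ /(_ (lshift n2 k))/derivable_lshift] /=.
by under eq_fun do rewrite row_mxKl row_mxKr.
Qed.

Lemma smooth_on_derivabler x u k :
  U (row_mx x u) -> derivable (g x) u 'e_k.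
Proof.
move=> /(@g_smooth [::])[_ /(_ (rshift n1 k))/derivable_rshift] /=.
by under eq_fun do rewrite row_mxKl row_mxKr.
Qed.

End SmoothSlices.

Lemma sum_kronecker (R : pzRingType) (I : finType) (a : I) (F : I -> R) :
  \sum_i (a == i)%:R * F i = F a.
Proof.
under eq_bigr do rewrite mulr_natl mulrb.
by rewrite -big_mkcond (big_pred1 a).
Qed.

Lemma delta_mx_neq0 (R : nzRingType) m n (i : 'I_m) (j : 'I_n) :
  delta_mx i j != 0 :> 'M[R]_(m, n).
Proof. by apply/eqP => /matrixP/(_ i j)/eqP; rewrite !mxE !eqxx oner_eq0. Qed.

Lemma row_free_col_rVP (F : fieldType) n (X Y : 'rV[F]_n) :
  reflect (forall s t, s *: X + t *: Y = 0 -> s = 0 /\ t = 0)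
          (row_free (col_mx X Y)).
Proof.
have combE s t : row_mx s%:M t%:M *m col_mx X Y = s *: X + t *: Y.
  by rewrite mul_row_col !mul_scalar_mx.
apply: (iffP idP) => [freeXY s t /eqP|indepXY].
  rewrite -combE mulmx_free_eq0 // row_mx_eq0.
  by move=> /andP[/eqP/matrixP/(_ 0 0) + /eqP/matrixP/(_ 0 0)]; rewrite !mxE.
rewrite -kermx_eq0; apply/rowV0P => v /sub_kermxP.
rewrite -[v]hsubmxK [lsubmx v]mx11_scalar [rsubmx v]mx11_scalar combE.
by move=> /indepXY[-> ->]; rewrite !raddf0 row_mx0.
Qed.

Section BilinearForm.
Context {R : fieldType} {n : nat} (A : 'M[R]_n).
Implicit Types X Y : 'rV[R]_n.

Lemma mulmx_tr_form X Y : (X *m A *m Y^T) 0 0 = form idfun A X Y.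
Proof. by rewrite /form map_mx_id. Qed.

Lemma form_sum X Y : form idfun A X Y = \sum_a \sum_b X 0 a * A a b * Y 0 b.
Proof.
rewrite -mulmx_tr_form mxE exchange_big; apply: eq_bigr => b _ /=.
by rewrite !mxE mulr_suml.
Qed.

Lemma form_sym X Y : A^T = A -> form idfun A X Y = form idfun A Y X.
Proof.
move=> symA; rewrite -!mulmx_tr_form -[LHS]trace_mx11 -mxtrace_tr trace_mx11.
by rewrite !trmx_mul trmxK symA mulmxA.
Qed.

Lemma polarization a b : A^T = A -> 2 != 0 :> R ->
  A a b = 2^-1 * (form idfun A ('e_a + 'e_b) ('e_a + 'e_b)
                  - form idfun A 'e_a 'e_a - form idfun A 'e_b 'e_b).
Proof.
move=> symA two_neq0; rewrite formDl !formDr !formee.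
by rewrite -[in A b a]symA mxE; field.
Qed.

End BilinearForm.

Definition posdefmx {R : numDomainType} {n : nat} (A : 'M[R]_n) : Prop :=
  forall w : 'rV[R]_n, w != 0 -> 0 < (w *m A *m w^T) 0 0.

Section PositiveDefinite.
Context {R : numFieldType} {n : nat} (A : 'M[R]_n).
Hypothesis posdefA : posdefmx A.

Lemma posdefmx_unit : A \in unitmx.
Proof.
rewrite unitmxE unitfE; apply/det0P => -[v v0 vA].
by have := posdefA v0; rewrite vA mul0mx mxE ltxx.
Qed.

Lemma posdefmx_inv : posdefmx (invmx A).
Proof.
move=> w w0; have wE : w = w *m invmx A *m A by rewrite mulmxKV ?posdefmx_unit.
have /posdefA : w *m invmx A != 0.
  by apply: contraNneq w0 => wA0; rewrite wE wA0 mul0mx.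
by rewrite -wE -trace_mx11 -mxtrace_tr trace_mx11 trmx_mul trmxK.
Qed.

Lemma posdefmx_gram_gt0 (X Y : 'rV[R]_n) :
  A^T = A -> row_free (col_mx X Y) ->
  0 < form idfun A X X * form idfun A Y Y - form idfun A X Y ^+ 2.
Proof.
move=> symA /row_free_col_rVP indepXY.
have form_gt0 w : w != 0 -> 0 < form idfun A w w.
  by rewrite -mulmx_tr_form; exact: posdefA.
have YY : 0 < form idfun A Y Y.
  apply: form_gt0; apply/eqP => Y0.
  have [|_ /eqP] := indepXY 0 1; first by rewrite Y0 scale0r scaler0 addr0.
  by rewrite oner_eq0.
pose w := form idfun A Y Y *: X + (- form idfun A X Y) *: Y.
have : w != 0 by apply/eqP => /indepXY[/eqP]; rewrite gt_eqF.
rewrite -(pmulr_rgt0 _ YY) => /form_gt0; congr (0 < _).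
rewrite /w formDl !formDr !formZl !formZr /= (form_sym Y X symA); ring.
Qed.

End PositiveDefinite.

Section FormDerivative.
Context {R : realFieldType} {n : nat} (A : 'M[R]_n).
Implicit Types a b v : 'rV[R]_n.

Lemma derive_forml a b v :
  'D_v (fun w => form idfun A w b) a = form idfun A v b.
Proof.
rewrite (derive_horner
  (p := (form idfun A a b)%:P + (form idfun A v b)%:P * 'X)).
  by rewrite coefD coefC coefCM coefX mulr1 add0r.
by move=> t; rewrite formDl formZl !hornerE; ring.
Qed.

Lemma derive_form_diag a v : A^T = A ->
  'D_v (fun w => form idfun A w w) a = 2 * form idfun A a v.
Proof.
move=> symA; pose q := form idfun A.
rewrite (derive_horner
  (p := (q a a)%:P + (2 * q a v)%:P * 'X + (q v v)%:P * 'X^2)).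
  by rewrite !coefD coefC !coefCM coefX coefXn mulr1 mulr0 add0r addr0.
move=> t; rewrite formDl !formDr !formZl !formZr (form_sym v a symA) !hornerE.
by rewrite /q /=; ring.
Qed.

End FormDerivative.

Definition half_hessian {R : realType} {n : nat} (E : 'rV[R]_n -> R)
    (y : 'rV[R]_n) : 'M[R]_n :=
  \matrix_(a, b) (2^-1 * partial a (partial b E) y).

Lemma fundamental_tensorE (R : realType) n (L : 'rV[R]_n -> 'rV[R]_n -> R) x y :
  fundamental_tensor L x y = half_hessian (energy L x) y.
Proof. by []. Qed.

Lemma half_hessian_form (R : realType) n (A : 'M[R]_n) y :
  A^T = A -> half_hessian (fun v => form idfun A v v) y = A.
Proof.
move=> symA; apply/matrixP => a b; rewrite mxE.
have -> : partial b (fun v => form idfun A v v) = form idfun A ^~ (2 *: 'e_b).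
  by apply/funext => v; rewrite /partial derive_form_diag // formZr.
by rewrite /partial derive_forml formZr formee /= mulKf ?pnatr_eq0.
Qed.

Lemma half_hessian_block (R : realType) n1 n2 (E1 : 'rV[R]_n1 -> R)
    (E2 : 'rV[R]_n2 -> R) (E : 'rV[R]_(n1 + n2) -> R) y v :
  (forall y v, E (row_mx y v) = E1 y + E2 v) ->
  half_hessian E (row_mx y v) =
  block_mx (half_hessian E1 y) 0 0 (half_hessian E2 v).
Proof.
move=> EE.
have dEl b y' v' : partial (lshift n2 b) E (row_mx y' v') = partial b E1 y'.
  rewrite partial_lshift; apply: eq_increment_derive => t.
  by rewrite !EE opprD addrACA subrr addr0.
have dEr b y' v' : partial (rshift n1 b) E (row_mx y' v') = partial b E2 v'.
  rewrite partial_rshift; apply: eq_increment_derive => t.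
  by rewrite !EE opprD addrACA subrr add0r.
apply/matrixP => a b; rewrite mxE.
case: (split_ordP a) => {}a ->; case: (split_ordP b) => {}b ->.
- rewrite block_mxEul mxE partial_lshift.
  by under eq_fun do rewrite dEl.
- rewrite block_mxEur mxE partial_lshift.
  by under eq_fun do rewrite dEr; rewrite partial_cst mulr0.
- rewrite block_mxEdl mxE partial_rshift.
  by under eq_fun do rewrite dEl; rewrite partial_cst mulr0.
- rewrite block_mxEdr mxE partial_rshift.
  by under eq_fun do rewrite dEr.
Qed.

Section ConstantCurvature.
Context {R : realType} {n : nat}.
Variables (h : 'rV[R]_n -> 'M[R]_n) (x : 'rV[R]_n) (K : R).
Hypothesis riemannE : forall a b c d : 'I_n, riemann h a b c d x =
  K * ((a == c)%:R * h x b d - (a == d)%:R * h x b c).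
Local Notation q := (metric_pairing h x).

Lemma riemann_op_const_curvature X Y Z :
  riemann_op h x X Y Z = K *: (q Z Y *: X - q Z X *: Y).
Proof.
apply/rowP => a; rewrite !mxE /metric_pairing !mulmx_tr_form !form_sum.
have contract b : \sum_c \sum_d riemann h a b c d x * X 0 c * Y 0 d * Z 0 b =
    K * (X 0 a * (\sum_d Z 0 b * h x b d * Y 0 d)
         - Y 0 a * (\sum_c Z 0 b * h x b c * X 0 c)).
  rewrite -(sum_kronecker a (fun c => X 0 c * _)).
  rewrite -(sum_kronecker a (fun d => Y 0 d * _)) mulrBr !mulr_sumr.
  transitivity (
    \sum_c \sum_d K * ((a == c)%:R * (X 0 c * (Z 0 b * h x b d * Y 0 d))) -
    \sum_d \sum_c K * ((a == d)%:R * (Y 0 d * (Z 0 b * h x b c * X 0 c)))).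
    rewrite [X in _ - X]exchange_big -sumrB; apply: eq_bigr => c _.
    by rewrite -sumrB; apply: eq_bigr => d _; rewrite riemannE; ring.
  by congr (_ - _); apply: eq_bigr => e _; rewrite !mulr_sumr.
under eq_bigr do rewrite contract.
by rewrite -mulr_sumr sumrB -!mulr_sumr [X 0 a * _]mulrC [Y 0 a * _]mulrC.
Qed.

Lemma sectional_curvature_const X Y :
  (h x)^T = h x -> posdefmx (h x) -> row_free (col_mx X Y) ->
  sectional_curvature h x X Y = K.
Proof.
move=> symh posh freeXY; have := posdefmx_gram_gt0 posh symh freeXY.
rewrite /sectional_curvature riemann_op_const_curvature /metric_pairing.
rewrite !mulmx_tr_form formZl formDl formNl !formZl (form_sym Y X symh).
by move=> /lt0r_neq0 gram_neq0; field.
Qed.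

End ConstantCurvature.

Lemma christoffel_sym (R : realType) n (h : 'rV[R]_n -> 'M[R]_n)
    (U : set 'rV[R]_n) c a b u : open U -> U u ->
  (forall v, U v -> (h v)^T = h v) ->
  christoffel h c a b u = christoffel h c b a u.
Proof.
move=> oU Uu symh; congr (_ * _); apply: eq_bigr => e _; congr (_ * _).
rewrite [X in X - _]addrC; congr (_ - _).
apply: (eq_on_partial _ oU Uu) => v /set_mem Uv.
by rewrite -[in LHS](symh v Uv) mxE.
Qed.

Lemma riemann_christoffel_sym (R : realType) n (h : 'rV[R]_n -> 'M[R]_n)
    (U : set 'rV[R]_n) a b c d u : open U -> U u ->
  (forall v, U v -> (h v)^T = h v) ->
  riemann h a b c d u =
  partial c (christoffel h a b d) u - partial d (christoffel h a b c) u
  + \sum_e christoffel h a c e u * christoffel h e b d u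
  - \sum_e christoffel h a d e u * christoffel h e b c u.
Proof.
move=> oU Uu symh; rewrite /riemann.
have : forall e p q v, U v -> christoffel h e p q v = christoffel h e q p v.
  by move=> e p q v Uv; exact: christoffel_sym oU Uv symh.
move: (christoffel h) => Gamma GammaC.
have partialC e p q : partial e (Gamma a p q) u = partial e (Gamma a q p) u.
  by apply: (eq_on_partial _ oU Uu) => v /set_mem; exact: GammaC.
rewrite (partialC c d b) (partialC d c b); congr (_ + _ - _);
  by apply: eq_bigr => e _; rewrite (GammaC e _ b).
Qed.

Section LocalGradient.
Context {R : realType} {n : nat}.
Variables (L : 'rV[R]_n -> 'rV[R]_n -> R) (phi : 'rV[R]_n -> R).
Implicit Types x y : 'rV[R]_n.

Definition differential x : 'rV[R]_n := \row_k partial k phi x.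

Definition gradient x y : 'cV[R]_n :=
  inverse_tensor L x y *m (differential x)^T.

Definition grad_sqnorm x y : R := (differential x *m gradient x y) 0 0.

Lemma grad_sqnorm_gt0 x y :
  posdefmx (fundamental_tensor L x y) -> differential x != 0 ->
  0 < grad_sqnorm x y.
Proof.
move=> posg dphi; rewrite /grad_sqnorm mulmxA.
exact: (posdefmx_inv posg dphi).
Qed.

End LocalGradient.

Lemma delta_eq_dbase (R : realType) n (L psi : 'rV[R]_n -> 'rV[R]_n -> R)
    a x y :
  (forall b, \forall t \near (0 : R), psi x (t *: 'e_b + y) = psi x y) ->
  delta L a psi x y = dbase a psi x y.
Proof.
move=> psi_cst; rewrite /delta big1 ?subr0 // => b _.
by rewrite [dfibre b _ _ _]derive_near_cst ?mulr0.
Qed.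

Section Warped.
Context {R : realType} {n1 n2 : nat}.
Variables (L : 'rV[R]_(n1 + n2) -> 'rV[R]_(n1 + n2) -> R).
Variables (L1 : 'rV[R]_n1 -> 'rV[R]_n1 -> R) (phi : 'rV[R]_n1 -> R).
Variables (h : 'rV[R]_n2 -> 'M[R]_n2).
Variables (U1 : set 'rV[R]_n1) (U2 : set 'rV[R]_n2).
Hypotheses (U1_open : open U1) (U2_open : open U2).
Hypothesis energyE : forall x u y v, U1 x -> U2 u ->
  energy L (row_mx x u) (row_mx y v) =
  energy L1 x y + phi x ^+ 2 * metric_pairing h u v v.
Hypothesis L1_unit : forall x y,
  U1 x -> y != 0 -> fundamental_tensor L1 x y \in unitmx.
Hypothesis phi_neq0 : forall x, U1 x -> phi x != 0.
Hypothesis phi_derivable : forall x k, U1 x -> derivable phi x 'e_k.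
Hypothesis h_sym : forall u, U2 u -> (h u)^T = h u.
Hypothesis h_unit : forall u, U2 u -> h u \in unitmx.
Hypothesis h_derivable : forall u a b k,
  U2 u -> derivable (fun u' => h u' a b) u 'e_k.

(* In lemma names, l and r stand for an index of the first and of the second
   factor. *)
Implicit Types (x y : 'rV[R]_n1) (u v : 'rV[R]_n2).

Lemma fundamental_tensor_warped x u y v : U1 x -> U2 u ->
  fundamental_tensor L (row_mx x u) (row_mx y v) =
  block_mx (fundamental_tensor L1 x y) 0 0 (phi x ^+ 2 *: h u).
Proof.
move=> U1x U2u; have symh : (phi x ^+ 2 *: h u)^T = phi x ^+ 2 *: h u.
  by rewrite linearZ /= h_sym.
rewrite !fundamental_tensorE -(half_hessian_form v symh).
apply: half_hessian_block => y' v'.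
by rewrite energyE // -mulmx_tr_form -scalemxAr -scalemxAl mxE.
Qed.

Lemma inverse_tensor_warped x u y v : U1 x -> U2 u -> y != 0 ->
  inverse_tensor L (row_mx x u) (row_mx y v) =
  block_mx (inverse_tensor L1 x y) 0 0 (phi x ^- 2 *: invmx (h u)).
Proof.
move=> U1x U2u y0; have phi2h_unit : phi x ^+ 2 *: h u \in unitmx.
  by rewrite unitmxZ ?h_unit // unitfE expf_neq0 ?phi_neq0.
rewrite /inverse_tensor fundamental_tensor_warped // invmx_block_diag.
  by rewrite invmxZ.
by rewrite block_diag_mx_unit L1_unit.
Qed.

Section FibreIndependent.
Variables (psi : 'rV[R]_(n1 + n2) -> 'rV[R]_(n1 + n2) -> R).
Variables (chi : 'rV[R]_n1 -> 'rV[R]_n2 -> R).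
Hypothesis psiE : forall x u y v, U1 x -> U2 u -> y != 0 ->
  psi (row_mx x u) (row_mx y v) = chi x u.

Lemma delta_fibre_independent c x u y v : U1 x -> U2 u -> y != 0 ->
  delta L c psi (row_mx x u) (row_mx y v) =
  dbase c psi (row_mx x u) (row_mx y v).
Proof.
move=> U1x U2u y0; apply: delta_eq_dbase => b.
have near_neq0 : \forall z \near row_mx y v, lsubmx z != 0.
  have /cvgr_neq0 := @continuous_lsubmx R 1 n1 n2 (row_mx y v).
  by rewrite row_mxKl; exact.
apply: filterS (near_line 'e_b near_neq0) => t.
move: (t *: 'e_b + row_mx y v) => z /=.
by rewrite -[z]hsubmxK row_mxKl => z0; rewrite !psiE.
Qed.

Lemma deltal_fibre_independent c x u y v : U1 x -> U2 u -> y != 0 ->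
  delta L (lshift n2 c) psi (row_mx x u) (row_mx y v) =
  partial c (fun x' => chi x' u) x.
Proof.
move=> U1x U2u y0; rewrite delta_fibre_independent // /dbase partial_lshift.
by apply: (eq_on_partial _ U1_open) => // x' /set_mem U1x'; exact: psiE.
Qed.

Lemma deltar_fibre_independent c x u y v : U1 x -> U2 u -> y != 0 ->
  delta L (rshift n1 c) psi (row_mx x u) (row_mx y v) = partial c (chi x) u.
Proof.
move=> U1x U2u y0; rewrite delta_fibre_independent // /dbase partial_rshift.
by apply: (eq_on_partial _ U2_open) => // u' /set_mem U2u'; exact: psiE.
Qed.

End FibreIndependent.

Lemma delta_eq0 (psi : 'rV[R]_(n1 + n2) -> 'rV[R]_(n1 + n2) -> R) c x u y v :
  (forall x u y v, U1 x -> U2 u -> y != 0 ->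
    psi (row_mx x u) (row_mx y v) = 0) ->
  U1 x -> U2 u -> y != 0 -> delta L c psi (row_mx x u) (row_mx y v) = 0.
Proof.
move=> psi0 U1x U2u y0; case: (split_ordP c) => {}c ->.
  rewrite (deltal_fibre_independent (chi := fun _ _ => 0)) //.
  exact: partial_cst.
rewrite (deltar_fibre_independent (chi := fun _ _ => 0)) //.
exact: partial_cst.
Qed.

Local Notation g a b := (fun X Y => fundamental_tensor L X Y a b).

Lemma delta_tensor_warped_lr c a b x u y v : U1 x -> U2 u -> y != 0 ->
  delta L c (g (lshift n2 a) (rshift n1 b)) (row_mx x u) (row_mx y v) = 0.
Proof.
apply: delta_eq0 => x' u' y' v' U1x' U2u' _.
by rewrite fundamental_tensor_warped // block_mxEur mxE.
Qed.

Lemma delta_tensor_warped_rl c a b x u y v : U1 x -> U2 u -> y != 0 ->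
  delta L c (g (rshift n1 a) (lshift n2 b)) (row_mx x u) (row_mx y v) = 0.
Proof.
apply: delta_eq0 => x' u' y' v' U1x' U2u' _.
by rewrite fundamental_tensor_warped // block_mxEdl mxE.
Qed.

Lemma deltal_tensor_warped_rr c a b x u y v : U1 x -> U2 u -> y != 0 ->
  delta L (lshift n2 c) (g (rshift n1 a) (rshift n1 b))
    (row_mx x u) (row_mx y v) =
  2 * phi x * differential phi x 0 c * h u a b.
Proof.
move=> U1x U2u y0.
rewrite (deltal_fibre_independent
  (chi := fun x u => h u a b * phi x ^+ 2)) //.
  have dphi : derivable phi x 'e_c by exact: phi_derivable.
  rewrite -[partial c _ x]/('D_('e_c) (h u a b \*o phi ^+ 2) x).
  rewrite deriveMl; last exact: derivableX.
  by rewrite deriveX // expr1 mxE /GRing.scale /= /partial; ring.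
move=> x' u' y' v' U1x' U2u' _.
by rewrite fundamental_tensor_warped // block_mxEdr mxE mulrC.
Qed.

Lemma deltar_tensor_warped_rr c a b x u y v : U1 x -> U2 u -> y != 0 ->
  delta L (rshift n1 c) (g (rshift n1 a) (rshift n1 b))
    (row_mx x u) (row_mx y v) =
  phi x ^+ 2 * partial c (fun u' => h u' a b) u.
Proof.
move=> U1x U2u y0.
rewrite (deltar_fibre_independent
  (chi := fun x u => phi x ^+ 2 * h u a b)) //.
  by rewrite /partial deriveMl //; exact: h_derivable.
move=> x' u' y' v' U1x' U2u' _.
by rewrite fundamental_tensor_warped // block_mxEdr mxE.
Qed.

Lemma hconnection_warped_r a b c x u y v : U1 x -> U2 u -> y != 0 ->
  hconnection L (rshift n1 a) b c (row_mx x u) (row_mx y v) =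
  2^-1 * \sum_e phi x ^- 2 * invmx (h u) a e *
    (delta L c (g (rshift n1 e) b) (row_mx x u) (row_mx y v)
     + delta L b (g (rshift n1 e) c) (row_mx x u) (row_mx y v)
     - delta L (rshift n1 e) (g b c) (row_mx x u) (row_mx y v)).
Proof.
move=> U1x U2u y0; rewrite /hconnection inverse_tensor_warped //.
rewrite big_split_ord /= big1 ?add0r => [|e _]; last first.
  by rewrite block_mxEdl mxE mul0r.
by congr (_ * _); apply: eq_bigr => e _; rewrite block_mxEdr mxE.
Qed.

Lemma hconnection_warped_rrr a b c x u y v : U1 x -> U2 u -> y != 0 ->
  hconnection L (rshift n1 a) (rshift n1 b) (rshift n1 c)
    (row_mx x u) (row_mx y v) = christoffel h a b c u.
Proof.
move=> U1x U2u y0; rewrite hconnection_warped_r //; congr (_ * _).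
apply: eq_bigr => e _; rewrite !deltar_tensor_warped_rr //.
by field; exact: phi_neq0.
Qed.

Lemma hconnection_warped_rrl a b k x u y v : U1 x -> U2 u -> y != 0 ->
  hconnection L (rshift n1 a) (rshift n1 b) (lshift n2 k)
    (row_mx x u) (row_mx y v) =
  (phi x)^-1 * differential phi x 0 k * (a == b)%:R.
Proof.
move=> U1x U2u y0; rewrite hconnection_warped_r //.
have -> : (a == b)%:R = (invmx (h u) *m h u) a b.
  by rewrite mulVmx ?h_unit // mxE.
rewrite [(_ *m _) a b]mxE !mulr_sumr; apply: eq_bigr => e _.
rewrite deltal_tensor_warped_rr // !delta_tensor_warped_rl //.
by field; exact: phi_neq0.
Qed.

Lemma hconnection_warped_lrr k b c x u y v : U1 x -> U2 u -> y != 0 ->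
  hconnection L (lshift n2 k) (rshift n1 b) (rshift n1 c)
    (row_mx x u) (row_mx y v) =
  - phi x * h u b c * gradient L1 phi x y k 0.
Proof.
move=> U1x U2u y0; rewrite /hconnection inverse_tensor_warped //.
rewrite big_split_ord /= [X in _ + X]big1 ?addr0 => [|e _]; last first.
  by rewrite block_mxEur mxE mul0r.
rewrite /gradient [(_ *m _) k 0]mxE !mulr_sumr; apply: eq_bigr => e _.
rewrite block_mxEul deltal_tensor_warped_rr // !delta_tensor_warped_lr //.
by rewrite [_^T _ _]mxE; field.
Qed.

Lemma hconnection_warped_contraction a b c d x u y v : U1 x -> U2 u -> y != 0 ->
  \sum_e hconnection L (rshift n1 a) (rshift n1 d) e (row_mx x u) (row_mx y v)
    * hconnection L e (rshift n1 b) (rshift n1 c) (row_mx x u) (row_mx y v) =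
  \sum_e christoffel h a d e u * christoffel h e b c u
  - grad_sqnorm L1 phi x y * ((a == d)%:R * h u b c).
Proof.
move=> U1x U2u y0; rewrite big_split_ord /= addrC; congr (_ + _).
  by apply: eq_bigr => e _; rewrite !hconnection_warped_rrr.
rewrite /grad_sqnorm [(_ *m _) 0 0]mxE -mulNr -sumrN mulr_suml.
apply: eq_bigr => k _.
rewrite hconnection_warped_rrl // hconnection_warped_lrr //.
by field; exact: phi_neq0.
Qed.

Lemma delta_hconnection_warped_rrr a b c d x u y v : U1 x -> U2 u -> y != 0 ->
  delta L (rshift n1 d)
    (hconnection L (rshift n1 a) (rshift n1 b) (rshift n1 c))
    (row_mx x u) (row_mx y v) = partial d (christoffel h a b c) u.
Proof.
apply: (deltar_fibre_independent (chi := fun _ => christoffel h a b c)).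
exact: hconnection_warped_rrr.
Qed.

Lemma hhcurvature_warped a b c d x u y v : U1 x -> U2 u -> y != 0 ->
  hhcurvature L (rshift n1 b) (rshift n1 a) (rshift n1 c) (rshift n1 d)
    (row_mx x u) (row_mx y v) =
  grad_sqnorm L1 phi x y * ((a == c)%:R * h u b d - (a == d)%:R * h u b c)
  - riemann h a b c d u.
Proof.
move=> U1x U2u y0; rewrite (riemann_christoffel_sym _ _ _ _ U2_open U2u h_sym).
rewrite /hhcurvature !delta_hconnection_warped_rrr //.
rewrite !hconnection_warped_contraction //.
move: (partial c _ u) (partial d _ u) (grad_sqnorm L1 phi x y).
move: (\sum_e christoffel h a c e u * _) (\sum_e christoffel h a d e u * _).
move: (_ * h u b c) (_ * h u b d) => *; ring.
Qed.

End Warped.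

Section Manifold.
Context {R : realType} {n : nat} {M : smooth_manifold R n}.

Lemma chart_image_coord (i : chart M) p :
  dom M i p -> chart_image i (coord M i p).
Proof. by exists p. Qed.

Lemma manifold_partial0_constant (g : M -> R) :
  (forall (i : chart M) x k, chart_image i x ->
    is_derive x 'e_k (g \o param M i) 0) ->
  forall p q, g p = g q.
Proof.
move=> dg; apply: connected_locally_constant => [|p].
  exact: manifold_connected.
have [i ip] := dom_cover p; have ix := chart_image_coord ip.
have /(coord_continuous ip) g_near :=
  partial0_locally_constant (@coord_image_open _ _ M i) ix (dg i).
have dom_near : \forall q \near p, dom M i q.
  by apply: open_nbhs_nbhs; split=> //; exact: dom_open.
by apply: filterS2 dom_near g_near => q iq; rewrite /= !coordK.
Qed.

Variable F : finsler_metric M.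

Lemma energy_derivable (i : chart M) x y (k : 'I_n) :
  chart_image i x -> y != 0 ->
  derivable (fun x' => energy (F i) x' y) x 'e_k.
Proof.
move=> ix y0.
rewrite (_ : (fun x' => _) = (fun x' => F i x' y) ^+ 2); last exact/funext.
apply/derivableX/(smooth_on_derivablel (@finsler_smooth _ _ _ F i)).
by rewrite /= row_mxKl row_mxKr.
Qed.

Variable h : chart M -> 'rV[R]_n -> 'M[R]_n.
Hypothesis riemF : is_riemannian F h.
Variables (i : chart M) (x : 'rV[R]_n).
Hypothesis ix : chart_image i x.

Lemma riemannian_sym : (h i x)^T = h i x.
Proof. by have [] := riemF ix. Qed.

Lemma riemannian_energy y : energy (F i) x y = form idfun (h i x) y y.
Proof. by have [_ FE] := riemF ix; rewrite /energy FE mulmx_tr_form. Qed.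

Lemma fundamental_tensor_riemannian y : fundamental_tensor (F i) x y = h i x.
Proof.
rewrite fundamental_tensorE (funext riemannian_energy).
exact: half_hessian_form riemannian_sym.
Qed.

Lemma riemannian_posdef : posdefmx (h i x).
Proof.
move=> w w0; rewrite -(fundamental_tensor_riemannian w).
exact: finsler_posdef.
Qed.

End Manifold.

Lemma riemannian_derivable (R : realType) n (M : smooth_manifold R n)
    (F : finsler_metric M) h (i : chart M) x a b (k : 'I_n) :
  is_riemannian F h -> chart_image i x ->
  derivable (fun x' => h i x' a b) x 'e_k.
Proof.
move=> riemF ix; have ea0 := delta_mx_neq0 R (0 : 'I_1) a.
have eb0 := delta_mx_neq0 R (0 : 'I_1) b.
have eab0 : 'e_a + 'e_b != 0 :> 'rV[R]_n.
  apply/eqP => /rowP/(_ a)/eqP; rewrite !mxE !eqxx /= -natrD pnatr_eq0.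
  by rewrite addn_eq0.
pose E w x' := energy (F i) x' w.
have dE w : w != 0 -> derivable (E w) x 'e_k by exact: energy_derivable.
have : derivable (fun x' => 2^-1 *
    (E ('e_a + 'e_b) x' - E 'e_a x' - E 'e_b x')) x 'e_k.
  apply: derivableM; first exact: derivable_cst.
  by apply: derivableB; [apply: derivableB|]; exact: dE.
apply: near_eq_derivable.
apply: filterS (open_nbhs_nbhs (conj (@coord_image_open _ _ M i) ix)) => z iz.
rewrite /E !(riemannian_energy riemF) //.
by rewrite -polarization ?pnatr_eq0 //; exact: (riemannian_sym riemF iz).
Qed.

Section TwistedProduct.
Context {R : realType} {n1 n2 : nat}.
Context {M1 : smooth_manifold R n1} {M2 : smooth_manifold R n2}.
Variables (F1 : finsler_metric M1) (F2 : finsler_metric M2) (f : M1 * M2 -> R).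
Hypothesis f_smooth : smooth_on_product f.
Implicit Types (i : chart M1) (j : chart M2).
Implicit Types (x y : 'rV[R]_n1) (u v : 'rV[R]_n2).

Lemma fun_expr_derivablel i j x u (k : 'I_n1) :
  chart_image i x -> chart_image j u ->
  derivable (fun x' => fun_expr f i j x' u) x 'e_k.
Proof.
move=> ix ju; apply: (smooth_on_derivablel (@f_smooth i j)).
by rewrite /= row_mxKl row_mxKr.
Qed.

Lemma fun_expr_derivabler i j x u (k : 'I_n2) :
  chart_image i x -> chart_image j u ->
  derivable (fun_expr f i j x) u 'e_k.
Proof.
move=> ix ju; apply: (smooth_on_derivabler (@f_smooth i j)).
by rewrite /= row_mxKl row_mxKr.
Qed.

Hypothesis f_first : function_on_first_factor f.

Lemma first_factor_constant p q q' : f (p, q) = f (p, q').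
Proof.
apply: (manifold_partial0_constant (g := fun q => f (p, q))) => j u k ju.
have [i ip] := dom_cover p; have ix := chart_image_coord ip.
have fE : fun_expr f i j (coord M1 i p) = (fun q => f (p, q)) \o param M2 j.
  by apply/funext => u'; rewrite /fun_expr coordK.
rewrite -fE; apply: DeriveDef; first exact: fun_expr_derivabler.
exact: f_first.
Qed.

Lemma fun_expr_first i j j' x u u' : fun_expr f i j x u = fun_expr f i j' x u'.
Proof. exact: first_factor_constant. Qed.

Lemma grad_norm2_first i j j' x y u u' :
  grad_norm2 F1 f i j x y u = grad_norm2 F1 f i j' x y u'.
Proof.
have dE : differential1 f i j x u = differential1 f i j' x u'.
  apply/rowP => k; rewrite !mxE; congr (partial k _ x); apply/funext => x'.
  exact: fun_expr_first.
by rewrite /grad_norm2 dE.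
Qed.

Lemma grad_norm2E i j x y u :
  grad_norm2 F1 f i j x y u =
  grad_sqnorm (F1 i) (fun x' => fun_expr f i j x' u) x y.
Proof.
rewrite /grad_norm2 (_ : differential1 _ _ _ _ _ =
  differential (fun x' => fun_expr f i j x' u) x) // /grad_sqnorm /gradient.
move: (differential _ x) => df; rewrite mxE; apply: eq_bigr => k _.
by rewrite mxE mulr_sumr; apply: eq_bigr => l _; rewrite mxE; ring.
Qed.

Lemma grad_norm2_gt0 i j x y u : chart_image i x -> y != 0 ->
  differential1 f i j x u != 0 -> 0 < grad_norm2 F1 f i j x y u.
Proof.
move=> ix y0 df; rewrite grad_norm2E; apply: grad_sqnorm_gt0 df => w w0.
exact: finsler_posdef.
Qed.

Hypothesis f_gt0 : forall p, 0 < f p.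
Variable h : chart M2 -> 'rV[R]_n2 -> 'M[R]_n2.
Hypothesis riemF2 : is_riemannian F2 h.

Lemma twisted_energy i j x u y v : chart_image i x -> chart_image j u ->
  energy (twisted_metric F1 F2 f i j) (row_mx x u) (row_mx y v) =
  energy (F1 i) x y
  + fun_expr f i j x u ^+ 2 * metric_pairing (h j) u v v.
Proof.
move=> ix ju; rewrite /energy /twisted_metric !row_mxKl !row_mxKr sqr_sqrtr.
  by have [_ ->] := riemF2 ju.
by rewrite addr_ge0 ?sqr_ge0 // mulr_ge0 ?sqr_ge0.
Qed.

Lemma hhcurvature_twisted i j a b c d x u y v :
  chart_image i x -> chart_image j u -> y != 0 ->
  hhcurvature (twisted_metric F1 F2 f i j) (rshift n1 b) (rshift n1 a)
    (rshift n1 c) (rshift n1 d) (row_mx x u) (row_mx y v) =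
  grad_norm2 F1 f i j x y u *
    ((a == c)%:R * h j u b d - (a == d)%:R * h j u b c)
  - riemann (h j) a b c d u.
Proof.
move=> ix ju y0; rewrite grad_norm2E.
apply: (hhcurvature_warped (U1 := chart_image i) (U2 := chart_image j)) => //.
- exact: coord_image_open.
- exact: coord_image_open.
- move=> x' u' y' v' ix' ju'; rewrite twisted_energy //.
  by rewrite (fun_expr_first i j j x' u' u).
- by move=> x' y' ix' y0'; apply: posdefmx_unit => w; exact: finsler_posdef.
- by move=> x' _; rewrite gt_eqF // /fun_expr.
- by move=> x' k ix'; exact: fun_expr_derivablel.
- by move=> u' ju'; exact: (riemannian_sym riemF2 ju').
- by move=> u' ju'; exact/posdefmx_unit/(riemannian_posdef riemF2 ju').
- by move=> u' a' b' k ju'; exact: riemannian_derivable riemF2 ju'.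
Qed.

Hypothesis flatF : twisted_flat F1 F2 f.

Lemma riemann_twisted_flat i j a b c d x u y :
  chart_image i x -> chart_image j u -> y != 0 ->
  riemann (h j) a b c d u =
  grad_norm2 F1 f i j x y u *
    ((a == c)%:R * h j u b d - (a == d)%:R * h j u b c).
Proof.
move=> ix ju y0; pose v : 'rV[R]_n2 := 'e_a.
apply/esym/eqP; rewrite -subr_eq0 -(hhcurvature_twisted a b c d v) //.
by apply/eqP; apply: flatF; rewrite ?row_mxKl ?row_mxKr // delta_mx_neq0.
Qed.

Lemma twisted_flat_constant_curvature i j x y u :
  chart_image i x -> y != 0 ->
  constant_curvature h (grad_norm2 F1 f i j x y u).
Proof.
move=> ix y0 j' u' X Y ju' freeXY; rewrite (grad_norm2_first i j j' x y u u').
apply: sectional_curvature_const freeXY.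
- by move=> a b c d; exact: riemann_twisted_flat.
- exact: (riemannian_sym riemF2 ju').
- exact: (riemannian_posdef riemF2 ju').
Qed.

End TwistedProduct.

Lemma constant_curvature_determined (R : realType) n (M : smooth_manifold R n)
    (h : chart M -> 'rV[R]_n -> 'M[R]_n) :
  (1 < n)%N -> exists K, forall K', constant_curvature h K' -> K' = K.
Proof.
move=> n_gt1; have [p _] := @manifold_nonempty _ _ M.
have [j /chart_image_coord ju] := dom_cover p.
pose a := Ordinal (ltnW n_gt1); pose b := Ordinal n_gt1.
have freeab : row_free (col_mx 'e_a 'e_b : 'M[R]_(1 + 1, n)).
  apply/row_free_col_rVP => s t /rowP st.
  have := st a; have := st b; rewrite !mxE /=.
  by rewrite !(mulr0, mulr1, add0r, addr0) => -> ->.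
exists (sectional_curvature (h j) (coord M j p) 'e_a 'e_b) => K hK.
exact/esym/hK.
Qed.

Theorem theorem4 (R : realType) (n1 n2 : nat)
    (M1 : smooth_manifold R n1) (M2 : smooth_manifold R n2)
    (F1 : finsler_metric M1) (F2 : finsler_metric M2)
    (f : M1 * M2 -> R)
    (f_gt0 : forall p, 0 < f p)
    (f_smooth : smooth_on_product f)
    (flatF : twisted_flat F1 F2 f)
    (h : chart M2 -> 'rV[R]_n2 -> 'M[R]_n2)
    (riemF2 : is_riemannian F2 h)
    (fM1 : function_on_first_factor f) :
  (forall (i : chart M1) (j : chart M2) (x y : 'rV[R]_n1) (u : 'rV[R]_n2),
     chart_image i x -> chart_image j u -> y != 0 ->
     constant_curvature h (grad_norm2 F1 f i j x y u) /\
     (differential1 f i j x u != 0 -> 0 < grad_norm2 F1 f i j x y u)) /\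
  ((1 < n2)%N -> exists K : R,
     forall (i : chart M1) (j : chart M2) (x y : 'rV[R]_n1) (u : 'rV[R]_n2),
     chart_image i x -> chart_image j u -> y != 0 ->
     grad_norm2 F1 f i j x y u = K).
Proof.
have curvature :=
  twisted_flat_constant_curvature f_smooth fM1 f_gt0 riemF2 flatF.
split=> [i j x y u ix ju y0|n2_gt1].
  by split; [exact: curvature | exact: grad_norm2_gt0].
have [K determined] := constant_curvature_determined h n2_gt1.
by exists K => i j x y u ix _ y0; exact/determined/curvature.
Qed.
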